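(* Let $G$ be a countable, discrete, abelian group, and let $(G,E)$ be a self-similar graph, where $E$ is a finite, source-free directed graph. Then the set $\mathcal{S}_{\mathrm{sym}}$ is an open, abelian, normal subgroupoid of $\mathcal{G}_{G,E}$.
   Context: Graphs. $\mathbb{N}=\{0,1,2,\dots\}$. A directed graph $E=(E^0,E^1,r,s)$ has vertex set $E^0$, edge set $E^1$, range and source maps $r,s\colon E^1\to E^0$. It is finite if $E^0,E^1$ are finite, and source-free if every vertex is the range of some edge. A path of length $n\ge1$ is a word $e_1\cdots e_n$ of edges with $s(e_i)=r(e_{i+1})$, with range $r(e_1)$ and source $s(e_n)$; vertices are the paths of length $0$. $E^*$ is the set of finite paths, $|\mu|$ the length. $E^\infty$ is the set of infinite paths $x=e_1e_2\cdots$ ($s(e_i)=r(e_{i+1})$), $r(x)=r(e_1)$; $x(m,n)=e_{m+1}\cdots e_n$ for $m<n$, $x(n,n)=r(e_{n+1})$. $vE^\infty$ is the set of infinite paths with range $v$. Self-similar graph $(G,E)$: $G$ acts on $E^*$ by bijections preserving lengths and commuting with $r,s$, with a restriction map $G\times E^*\to G$, $(g,\mu)\mapsto g|_\mu$, such that $(gh)|_\mu=g|_{h\cdot\mu}h|_\mu$; $g|_v=g$ for $v\in E^0$; $1_G|_\mu=1_G$; $g|_{\mu\nu}=g|_\mu|_\nu$ and $g\cdot(\mu\nu)=(g\cdot\mu)(g|_\mu\cdot\nu)$ whenever $s(\mu)=r(\nu)$. The action extends to $E^\infty$ by $(g\cdot x)(p,q)=g|_{x(0,p)}\cdot x(p,q)$,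 and $g|_x\colon\mathbb{N}\to G$ is $p\mapsto g|_{x(0,p)}$. Groupoid. $Q(\mathbb{N},G)$ is the group of functions $\mathbb{N}\to G$ (pointwise product) modulo eventual equality, $[f]$ the class of $f$. For $n\in\mathbb{Z}$, $\mathcal{T}_n(f)(p)=f(p-n)$ if $p\ge n$ and $1_G$ otherwise, inducing an automorphism $\mathcal{T}_n$ of $Q(\mathbb{N},G)$. Then $$\mathcal{G}_{G,E}=\{(\mu(g\cdot x);\mathcal{T}_{|\mu|}([g|_x]),|\mu|-|\nu|;\nu x): g\in G,\ \mu,\nu\in E^*,\ s(\mu)=g\cdot s(\nu),\ x\in s(\nu)E^\infty\}$$ with $r(x;[f],k;y)=(x;[1_G],0;x)$, $s(x;[f],k;y)=(y;[1_G],0;y)$, product $(x;[f],k;y)(y;[h],l;z)=(x;[f]\mathcal{T}_k([h]),k+l;z)$, inverse $(y;\mathcal{T}_{-k}([f]^{-1}),-k;x)$. Its topology is generated by the cylinder sets $\mathcal{Z}(\mu,g,\nu)=\{(\mu(g\cdot x);\mathcal{T}_{|\mu|}([g|_x]),|\mu|-|\nu|;\nu x):x\in s(\nu)E^\infty\}$ with $s(\mu)=g\cdot s(\nu)$. Cycline triples. $(\mu,g,\nu)$ with $\mu,\nu\in E^*$, $g\in G$ is a cycline triple if $s(\mu)=g\cdot s(\nu)$ and $\mu(g\cdot x)=\nu x$ for all $x\in s(\nu)E^\infty$; it is symmetric if $\mu=\nu$. $\mathcal{S}_{\mathrm{sym}}$ is the union of the sets $\mathcal{Z}(\mu,g,\mu)$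 over all symmetric cycline triples $(\mu,g,\mu)$; it is contained in the isotropy $\operatorname{Iso}(\mathcal{G}_{G,E})=\{\mathfrak g:r(\mathfrak g)=s(\mathfrak g)\}$. A subgroupoid $\mathcal{S}\subseteq\operatorname{Iso}(\mathcal{G})$ is abelian if any two composable elements of it commute. A subgroupoid $\mathcal{S}$ with $\mathcal{G}^{(0)}\subseteq\mathcal{S}\subseteq\operatorname{Iso}(\mathcal{G})$ is normal in $\mathcal{G}$ if $\mathfrak g\mathfrak t\mathfrak g^{-1}\in\mathcal{S}$ for all $\mathfrak g\in\mathcal{G}$ and $\mathfrak t\in\mathcal{S}$ with $r(\mathfrak t)=s(\mathfrak g)$. *)

(* Defs.v *)
From HB Require Import structures.
From mathcomp Require Import all_boot all_order all_algebra.
From mathcomp Require Import finmap.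
From mathcomp Require Import boolp classical_sets functions cardinality topology.
From mathcomp Require Import zify.

Set Implicit Arguments.
Unset Strict Implicit.
Unset Printing Implicit Defensive.

Import Order.TTheory GRing.Theory Num.Theory.

Local Open Scope classical_set_scope.
Local Open Scope group_scope.

Record finite_digraph := FiniteDigraph {
  vertex : finType;
  edge : finType;
  rng : edge -> vertex;
  src : edge -> vertex
}.

Definition source_free (E : finite_digraph) : Prop :=
  forall v : vertex E, exists e : edge E, rng e = v.

Section FinitePaths.
Variable E : finite_digraph.
Implicit Types (v : vertex E) (w : seq (edge E)).

Fixpoint is_path v w : bool :=
  if w is e :: w' then (rng e == v) && is_path (src e) w' else true.

(* A path is stored as its range together with its word of edges: the pair
   (v, [::]) is the vertex v, and for a nonempty word the range is forced to
   be the range of the first edge. *)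
Record fpath := FPath {
  path_val :> vertex E * seq (edge E);
  path_valP : is_path path_val.1 path_val.2
}.

HB.instance Definition _ := [isSub for path_val].
HB.instance Definition _ := [Choice of fpath by <:].

Definition prange (mu : fpath) : vertex E := mu.1.
Definition pword (mu : fpath) : seq (edge E) := mu.2.
Definition psource (mu : fpath) : vertex E :=
  last (prange mu) [seq src e | e <- pword mu].
Definition plen (mu : fpath) : nat := size (pword mu).

Definition vpath v : fpath := @FPath (v, [::]) isT.

(* Concatenation; meaningful only when psource mu = prange nu. *)
Definition pcat (mu nu : fpath) : fpath :=
  insubd mu (prange mu, pword mu ++ pword nu).

Lemma is_path_cat v w1 w2 :
  is_path v (w1 ++ w2) =
  is_path v w1 && is_path (last v [seq src e | e <- w1]) w2.
Proof. by elim: w1 v => //= e w1 IH v; rewrite IH andbA. Qed.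

Lemma fpath_eqP (mu nu : fpath) :
  prange mu = prange nu -> pword mu = pword nu -> mu = nu.
Proof.
case: mu nu => [[v w] vw] [[v' w'] vw']; rewrite /prange /pword /= => e1 e2.
by apply: val_inj; rewrite /= e1 e2.
Qed.

Lemma val_pcat (mu nu : fpath) : psource mu = prange nu ->
  path_val (pcat mu nu) = (prange mu, pword mu ++ pword nu).
Proof.
move=> h; rewrite /pcat; apply: insubdK; rewrite unfold_in /= is_path_cat.
by rewrite (path_valP mu) -/(psource mu) h (path_valP nu).
Qed.

End FinitePaths.

Section InfinitePaths.
Variable E : finite_digraph.

(* The path e_1 e_2 e_3 ... is stored as the sequence n |-> e_(n+1). *)
Record ipath := IPath {
  iedge :> nat -> edge E;
  iedgeP : `[< forall n, src (iedge n) = rng (iedge n.+1) >]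
}.

HB.instance Definition _ := [isSub for iedge].
HB.instance Definition _ := [Choice of ipath by <:].

Implicit Types x : ipath.

Definition irange x : vertex E := rng (x 0).

Lemma ipath_src x n : src (x n) = rng (x n.+1).
Proof. by have /asboolP := iedgeP x. Qed.

Lemma seg_subproof x m k : is_path (rng (x m)) [seq x i | i <- iota m k].
Proof. by elim: k m => //= k IH m; rewrite eqxx ipath_src IH. Qed.

(* seg x m n is x(m, n), for m <= n. *)
Definition seg x (m n : nat) : fpath E :=
  @FPath E (rng (x m), [seq x i | i <- iota m (n - m)]) (seg_subproof x m _).

(* Concatenation; meaningful only when psource mu = irange x. *)
Definition icat (mu : fpath E) x : ipath :=
  insubd x (fun n => if n < plen mu then nth (x 0) (pword mu) n
                     else x (n - plen mu)).

End InfinitePaths.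

(* The axiom act_comp says that the concatenation on the right-hand side of
   act_cat makes sense. *)
Record self_similar_action (G : groupType) (E : finite_digraph) :=
  SelfSimilarAction {
  act : G -> fpath E -> fpath E;
  restr : G -> fpath E -> G;
  act1 : forall mu, act 1 mu = mu;
  actM : forall g h mu, act (g * h) mu = act g (act h mu);
  act_len : forall g mu, plen (act g mu) = plen mu;
  act_range : forall g mu, vpath (prange (act g mu)) = act g (vpath (prange mu));
  act_source : forall g mu,
    vpath (psource (act g mu)) = act g (vpath (psource mu));
  restrM : forall g h mu, restr (g * h) mu = restr g (act h mu) * restr h mu;
  restr_vertex : forall g v, restr g (vpath v) = g;
  restr1 : forall mu, restr 1 mu = 1;
  restr_cat : forall g mu nu, psource mu = prange nu ->
    restr g (pcat mu nu) = restr (restr g mu) nu;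
  act_comp : forall g mu nu, psource mu = prange nu ->
    psource (act g mu) = prange (act (restr g mu) nu);
  act_cat : forall g mu nu, psource mu = prange nu ->
    act g (pcat mu nu) = pcat (act g mu) (act (restr g mu) nu)
}.

Section PathLemmas.
Variable E : finite_digraph.
Implicit Types (mu nu : fpath E) (x : ipath E).

Lemma prange_seg x m n : prange (seg x m n) = rng (x m).
Proof. by []. Qed.

Lemma pword_seg x m n : pword (seg x m n) = [seq x i | i <- iota m (n - m)].
Proof. by []. Qed.

Lemma psource_seg x m n : m <= n -> psource (seg x m n) = rng (x n).
Proof.
move=> mn; rewrite /psource prange_seg pword_seg -{2}(subnKC mn).
move: (n - m) => k; elim: k m {mn} => [|k IH] m /=; first by rewrite addn0.
by rewrite ipath_src IH addnS addSn.
Qed.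

Lemma plen_seg x m n : plen (seg x m n) = n - m.
Proof. by rewrite /plen pword_seg size_map size_iota. Qed.

Lemma seg_nn x n : seg x n n = vpath (rng (x n)).
Proof. by apply: fpath_eqP => //; rewrite pword_seg subnn. Qed.

Lemma seg_cat x m n p : m <= n -> n <= p ->
  seg x m p = pcat (seg x m n) (seg x n p).
Proof.
move=> mn np; apply: val_inj; rewrite [RHS]val_pcat ?psource_seg //=.
rewrite pword_seg -map_cat; congr (_, map _ _).
have -> : p - m = (n - m) + (p - n) by rewrite addnC addnBA // subnK.
by rewrite iotaD subnKC.
Qed.

Lemma val_icat mu x : psource mu = irange x ->
  iedge (icat mu x) = (fun n => if n < plen mu then nth (x 0) (pword mu) n
                                else x (n - plen mu)).
Proof.
move=> h; rewrite /icat; apply: (@insubdK _ _ (ipath E)).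
apply/asboolP => n.
have := path_valP mu; rewrite -/(prange mu) -/(pword mu) => pm.
move: h; rewrite /psource /irange /plen.
elim: (pword mu) (prange mu) pm n => [|e w IH] v /=.
  by move=> _ n h; rewrite !subn0 ipath_src.
move=> /andP[/eqP ev pw] [|n] h /=; last by rewrite !ltnS !subSS; exact: IH pw n h.
case: w pw {IH} h => [|f w] /=; first by move=> _ ->; rewrite subn1.
by move=> /andP[/eqP -> _].
Qed.

End PathLemmas.

Section InfiniteAction.
Variables (G : groupType) (E : finite_digraph) (A : self_similar_action G E).
Implicit Types (g h : G) (mu nu : fpath E) (x : ipath E).

Definition vact g (v : vertex E) : vertex E := prange (act A g (vpath v)).

Definition iact_edge g x (n : nat) : edge E :=
  head (x n) (pword (act A (restr A g (seg x 0 n)) (seg x n n.+1))).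

Lemma word_iact_edge g x n :
  pword (act A (restr A g (seg x 0 n)) (seg x n n.+1)) = [:: iact_edge g x n].
Proof.
rewrite /iact_edge; have := act_len A (restr A g (seg x 0 n)) (seg x n n.+1).
by rewrite plen_seg subSnn /plen; case: (pword _) => [|e [|]].
Qed.

Lemma range_word1 mu e : pword mu = [:: e] -> prange mu = rng e.
Proof.
case: mu => -[v w] /= vw; rewrite /pword /prange /= => ew.
by move: vw; rewrite ew /= andbT => /eqP.
Qed.

Lemma iact_subproof g x :
  `[< forall n, src (iact_edge g x n) = rng (iact_edge g x n.+1) >].
Proof.
apply/asboolP => n.
rewrite -(range_word1 (word_iact_edge g x n.+1)).
have -> : seg x 0 n.+1 = pcat (seg x 0 n) (seg x n n.+1) by exact: seg_cat.
rewrite restr_cat ?psource_seg // -act_comp ?psource_seg //.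
by rewrite /psource word_iact_edge.
Qed.

(* The action on infinite paths: the n-th edge of g . x is
   g|_(x(0,n)) . x(n,n+1), and iact_seg recovers the general formula for
   (g . x)(m,n). *)
Definition iact g x : ipath E := IPath (iact_subproof g x).

Definition irestr g x : nat -> G := fun p => restr A g (seg x 0 p).

Lemma iact_seg g x m n : m <= n ->
  seg (iact g x) m n = act A (restr A g (seg x 0 m)) (seg x m n).
Proof.
move=> mn; rewrite -(subnKC mn); elim: (n - m) => [|k IH].
  rewrite addn0 !seg_nn -[rng (x m)](prange_seg x m m.+1) -act_range.
  by rewrite (range_word1 (word_iact_edge g x m)).
have h1 : m <= m + k by exact: leq_addr.
have h2 : m + k <= m + k.+1 by rewrite addnS.
rewrite (seg_cat x h1 h2) (seg_cat _ h1 h2) IH act_cat ?psource_seg //.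
congr pcat; rewrite -restr_cat ?psource_seg // -seg_cat // addnS.
have w := word_iact_edge g x (m + k).
apply: fpath_eqP; first by rewrite (range_word1 w).
by rewrite w pword_seg subSnn.
Qed.

End InfiniteAction.

Section Germs.
Variable G : groupType.
Implicit Types f h : nat -> G.

Definition eventually_eq f h : bool :=
  `[< exists N, forall p, (N <= p)%N -> f p = h p >].

Lemma eventually_eq_is_equiv : equiv_class_of eventually_eq.
Proof.
split=> [f|f h|f h k].
- by apply/asboolP; exists 0%N.
- by apply/asboolP/asboolP => -[N fh]; exists N => p /fh.
- move=> /asboolP[N hN] /asboolP[M hM]; apply/asboolP.
  exists (maxn N M) => p; rewrite geq_max => /andP[Np Mp].
  by rewrite hN // hM.
Qed.

Canonical eventually_eq_equiv := EquivRelPack eventually_eq_is_equiv.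
Canonical eventually_eq_encModRel := defaultEncModRel eventually_eq.

Definition germ := {eq_quot eventually_eq}%qT.
HB.instance Definition _ := Choice.on germ.
HB.instance Definition _ := EqQuotient.on germ.

Definition germ_of f : germ := (\pi_germ f)%qT.

Lemma germ_ofP f h :
  germ_of f = germ_of h <-> exists N, forall p, (N <= p)%N -> f p = h p.
Proof.
split=> [e|fh]; last by apply/eqquotP/asboolP.
by move/eqquotP: e => /asboolP.
Qed.

End Germs.

Section GermGroup.
Variable G : groupType.
Implicit Types (f h : nat -> G) (a b : germ G) (m n : int).

Definition germ_mul a b : germ G := germ_of (fun p => repr a p * repr b p).
Definition germ_inv a : germ G := germ_of (fun p => (repr a p)^-1).
Definition germ_one : germ G := germ_of (fun _ => 1).

Lemma germ_of_repr a : germ_of (repr a) = a.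
Proof. exact: reprK. Qed.

Lemma repr_germ_of f : exists N, forall p, (N <= p)%N -> repr (germ_of f) p = f p.
Proof. by apply/germ_ofP; exact: germ_of_repr. Qed.

Lemma germ_mulE f h : germ_mul (germ_of f) (germ_of h) = germ_of (fun p => f p * h p).
Proof.
apply/germ_ofP; have [N hN] := repr_germ_of f; have [M hM] := repr_germ_of h.
by exists (maxn N M) => p; rewrite geq_max => /andP[Np Mp]; rewrite hN // hM.
Qed.

Lemma germ_invE f : germ_inv (germ_of f) = germ_of (fun p => (f p)^-1).
Proof.
apply/germ_ofP; have [N hN] := repr_germ_of f.
by exists N => p Np; rewrite hN.
Qed.

Lemma germ_mulA : associative germ_mul.
Proof.
move=> a b c; rewrite -(germ_of_repr a) -(germ_of_repr b) -(germ_of_repr c).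
by rewrite !germ_mulE; congr germ_of; apply/funext => p; rewrite mulgA.
Qed.

Lemma germ_mul1g : left_id germ_one germ_mul.
Proof.
move=> a; rewrite -{1}(germ_of_repr a) germ_mulE -[RHS]germ_of_repr.
by congr germ_of; apply/funext => p; rewrite mul1g.
Qed.

Lemma germ_mulg1 : right_id germ_one germ_mul.
Proof.
move=> a; rewrite -{1}(germ_of_repr a) germ_mulE -[RHS]germ_of_repr.
by congr germ_of; apply/funext => p; rewrite mulg1.
Qed.

Lemma germ_mulVg : left_inverse germ_one germ_inv germ_mul.
Proof.
move=> a; rewrite -(germ_of_repr a) germ_invE germ_mulE.
by congr germ_of; apply/funext => p; rewrite mulVg.
Qed.

Lemma germ_mulgV : right_inverse germ_one germ_inv germ_mul.
Proof.
move=> a; rewrite -(germ_of_repr a) germ_invE germ_mulE.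
by congr germ_of; apply/funext => p; rewrite mulgV.
Qed.

(* germ G is the group Q(N, G). *)
HB.instance Definition _ := isGroup.Build (germ G)
  germ_mulA germ_mul1g germ_mulg1 germ_mulVg germ_mulgV.

Lemma germ_ofM f h : germ_of f * germ_of h = germ_of (fun p => f p * h p).
Proof. exact: germ_mulE. Qed.

Lemma germ_ofV f : (germ_of f)^-1 = germ_of (fun p => (f p)^-1).
Proof. exact: germ_invE. Qed.

Definition shift n f (p : nat) : G :=
  if (n <= p%:Z)%R then f (absz (p%:Z - n)%R) else 1.

Definition germ_shift n a : germ G := germ_of (shift n (repr a)).

Lemma shiftE n f (p q : nat) : (p%:Z = q%:Z + n)%R -> shift n f p = f q.
Proof.
move=> e; rewrite /shift; have -> : (n <= p%:Z)%R by lia.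
by congr f; lia.
Qed.

Lemma germ_shiftE n f : germ_shift n (germ_of f) = germ_of (shift n f).
Proof.
apply/germ_ofP; have [N hN] := repr_germ_of f.
exists (N + absz n)%N => p Np.
have e : (p%:Z = Posz (absz (p%:Z - n)%R) + n)%R by lia.
by rewrite !(shiftE _ e) hN //; lia.
Qed.

Lemma germ_shift0 a : germ_shift 0%R a = a.
Proof.
rewrite -(germ_of_repr a) germ_shiftE; apply/germ_ofP; exists 0%N => p _.
by apply: shiftE; lia.
Qed.

Lemma germ_shiftD m n a : germ_shift (m + n)%R a = germ_shift m (germ_shift n a).
Proof.
rewrite -(germ_of_repr a) !germ_shiftE; apply/germ_ofP.
exists (absz m + absz n)%N => p Np.
have e1 : (p%:Z = Posz (absz (p%:Z - m)%R) + m)%R by lia.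
have e2 : (Posz (absz (p%:Z - m)%R) = Posz (absz (p%:Z - m - n)%R) + n)%R by lia.
rewrite (shiftE _ e1) (shiftE _ e2); apply: shiftE; lia.
Qed.

Lemma germ_shiftM n a b : germ_shift n (a * b) = germ_shift n a * germ_shift n b.
Proof.
rewrite -(germ_of_repr a) -(germ_of_repr b) germ_ofM !germ_shiftE germ_ofM.
apply/germ_ofP; exists 0%N => p _; rewrite /shift; case: ifP => // _.
by rewrite mulg1.
Qed.

Lemma germ_shift1 n : germ_shift n 1 = 1.
Proof.
have e := germ_shiftM n 1 1; rewrite mulg1 in e.
by apply: (mulgI (germ_shift n 1)); rewrite -e mulg1.
Qed.

Lemma germ_shiftV n a : germ_shift n a^-1 = (germ_shift n a)^-1.
Proof.
have := germ_shiftM n a^-1 a; rewrite mulVg germ_shift1 => e.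
by rewrite -[RHS]mul1g e mulgK.
Qed.

End GermGroup.

HB.mixin Record isGroupoid T := {
  gpd_range : T -> T;
  gpd_source : T -> T;
  (* Meaningful only on composable pairs. *)
  gpd_mul : T -> T -> T;
  gpd_inv : T -> T;
  gpd_range_range : forall a, gpd_range (gpd_range a) = gpd_range a;
  gpd_source_range : forall a, gpd_source (gpd_range a) = gpd_range a;
  gpd_range_source : forall a, gpd_range (gpd_source a) = gpd_source a;
  gpd_source_source : forall a, gpd_source (gpd_source a) = gpd_source a;
  gpd_range_mul : forall a b, gpd_source a = gpd_range b ->
    gpd_range (gpd_mul a b) = gpd_range a;
  gpd_source_mul : forall a b, gpd_source a = gpd_range b ->
    gpd_source (gpd_mul a b) = gpd_source b;
  gpd_mulA : forall a b c,
    gpd_source a = gpd_range b -> gpd_source b = gpd_range c ->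
    gpd_mul a (gpd_mul b c) = gpd_mul (gpd_mul a b) c;
  gpd_mul1g : forall a, gpd_mul (gpd_range a) a = a;
  gpd_mulg1 : forall a, gpd_mul a (gpd_source a) = a;
  gpd_range_inv : forall a, gpd_range (gpd_inv a) = gpd_source a;
  gpd_source_inv : forall a, gpd_source (gpd_inv a) = gpd_range a;
  gpd_mulgV : forall a, gpd_mul a (gpd_inv a) = gpd_range a;
  gpd_mulVg : forall a, gpd_mul (gpd_inv a) a = gpd_source a
}.

#[short(type="groupoidType")]
HB.structure Definition Groupoid := {T of isGroupoid T}.

Section GroupoidNotions.
Variable T : groupoidType.
Implicit Types (a b : T) (S : set T).

Definition units : set T := [set gpd_range a | a in [set: T]].

Definition isotropy : set T := [set a | gpd_range a = gpd_source a].

Definition subgroupoid S : Prop :=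
  (forall a b, S a -> S b -> gpd_source a = gpd_range b -> S (gpd_mul a b)) /\
  (forall a, S a -> S (gpd_inv a)).

(* gpd_abelian and gpd_normal are meant to be applied to subgroupoids. *)
Definition gpd_abelian S : Prop :=
  S `<=` isotropy /\
  forall a b, S a -> S b -> gpd_source a = gpd_range b ->
    gpd_mul a b = gpd_mul b a.

Definition gpd_normal S : Prop :=
  [/\ units `<=` S, S `<=` isotropy &
      forall a t, S t -> gpd_range t = gpd_source a ->
        S (gpd_mul (gpd_mul a t) (gpd_inv a))].

End GroupoidNotions.

Section InfiniteActionTheory.
Variables (G : groupType) (E : finite_digraph) (A : self_similar_action G E).
Implicit Types (g h : G) (mu nu : fpath E) (x y : ipath E).

Lemma ipath_eqP x y : (forall n, x n = y n) -> x = y.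
Proof. by move=> xy; apply: val_inj; apply/funext. Qed.

Lemma seg_edge x n : pword (seg x n n.+1) = [:: x n].
Proof. by rewrite pword_seg subSnn. Qed.

Lemma ipath_segP x y : (forall n, seg x n n.+1 = seg y n n.+1) -> x = y.
Proof.
move=> xy; apply: ipath_eqP => n.
by have /(congr1 (@pword E)) := xy n; rewrite !seg_edge => -[].
Qed.

Lemma ipath_seg0P x y : (forall n, seg x 0 n = seg y 0 n) -> x = y.
Proof.
move=> xy; apply: ipath_eqP => n.
have /(congr1 (fun s => nth (x n) (pword s) n)) := xy n.+1.
by rewrite !pword_seg !subn0 !(nth_map 0%N) ?size_iota // nth_iota.
Qed.

Lemma irange_iact g x : irange (iact A g x) = vact A g (irange x).
Proof.
have := iact_seg A g x (leqnn 0); rewrite !seg_nn restr_vertex.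
by move/(congr1 (@prange E)).
Qed.

Lemma seg_iact0 g x p : seg (iact A g x) 0 p = act A g (seg x 0 p).
Proof. by rewrite iact_seg // seg_nn restr_vertex. Qed.

Lemma iact1 x : iact A 1 x = x.
Proof. by apply: ipath_seg0P => n; rewrite seg_iact0 act1. Qed.

Lemma iactM g h x : iact A (g * h) x = iact A g (iact A h x).
Proof. by apply: ipath_seg0P => n; rewrite !seg_iact0 actM. Qed.

Lemma iactK g x : iact A g^-1 (iact A g x) = x.
Proof. by rewrite -iactM mulVg iact1. Qed.

Lemma irestrM g h x p :
  irestr A (g * h) x p = irestr A g (iact A h x) p * irestr A h x p.
Proof. by rewrite /irestr restrM seg_iact0. Qed.

Lemma irestr1 x p : irestr A 1 x p = 1.
Proof. exact: restr1. Qed.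

Lemma irestrV g x p : irestr A g^-1 (iact A g x) p = (irestr A g x p)^-1.
Proof.
by apply: (mulIg (irestr A g x p)); rewrite -irestrM !mulVg irestr1.
Qed.

Lemma vact1 v : vact A 1 v = v.
Proof. by rewrite /vact act1. Qed.

Lemma vactM g h v : vact A (g * h) v = vact A g (vact A h v).
Proof. by rewrite /vact actM act_range. Qed.

Lemma vactK g v : vact A g^-1 (vact A g v) = v.
Proof. by rewrite -vactM mulVg vact1. Qed.

Lemma psource_act g mu : psource (act A g mu) = vact A g (psource mu).
Proof. by have := act_source A g mu; move/(congr1 (@prange E)). Qed.

Lemma prange_act g mu : prange (act A g mu) = vact A g (prange mu).
Proof. by have := act_range A g mu; move/(congr1 (@prange E)). Qed.

Lemma vact_restr g mu :
  vact A (restr A g mu) (psource mu) = vact A g (psource mu).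
Proof.
by rewrite -[RHS]psource_act (act_comp A g (nu := vpath (psource mu))).
Qed.

Lemma psource_pcat mu nu : psource mu = prange nu ->
  psource (pcat mu nu) = psource nu.
Proof.
move=> h; have := val_pcat h; rewrite {1}/psource /prange /pword => ->/=.
by rewrite map_cat last_cat -/(prange mu) -/(pword mu) -/(psource mu) h.
Qed.

Lemma plen_pcat mu nu : psource mu = prange nu ->
  plen (pcat mu nu) = (plen mu + plen nu)%N.
Proof.
by move=> h; have := val_pcat h; rewrite /plen /pword => -> /=; rewrite size_cat.
Qed.

Lemma irange_icat mu x : psource mu = irange x -> irange (icat mu x) = prange mu.
Proof.
move=> h; rewrite /irange val_icat // lt0n /plen sub0n.
have := path_valP mu; rewrite -/(prange mu) -/(pword mu).
move: h; rewrite /psource /irange.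
by case: (pword mu) => [|e w] /= h; [rewrite h | case/andP => /eqP].
Qed.

Lemma icat_vpath v x : v = irange x -> icat (vpath v) x = x.
Proof.
by move=> h; apply: ipath_eqP => n; rewrite val_icat // /plen /= subn0.
Qed.

Lemma seg_icat mu x p : psource mu = irange x ->
  seg (icat mu x) 0 (plen mu + p) = pcat mu (seg x 0 p).
Proof.
move=> h; apply: fpath_eqP.
  rewrite prange_seg -/(irange _) irange_icat //.
  by have /(congr1 fst) := @val_pcat _ mu (seg x 0 p) h.
have /(congr1 snd) := @val_pcat _ mu (seg x 0 p) h.
rewrite -/(pword _) => -> /=.
rewrite !pword_seg !subn0 iotaD map_cat add0n; congr (_ ++ _).
  apply: (@eq_from_nth _ (x 0)); first by rewrite size_map size_iota.
  move=> i; rewrite size_map size_iota => ip.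
  by rewrite (nth_map 0%N) ?size_iota // nth_iota // val_icat // add0n ip.
rewrite -[X in iota X _]addn0 iotaDl -map_comp; apply: eq_map => i /=.
by rewrite val_icat // ltnNge leq_addr addKn.
Qed.

Lemma seg_icat0 mu x : psource mu = irange x -> seg (icat mu x) 0 (plen mu) = mu.
Proof.
move=> h; rewrite -[X in seg _ _ X]addn0 seg_icat // seg_nn.
have := @val_pcat _ mu (vpath (rng (x 0))) h; rewrite cats0 => e.
by apply: fpath_eqP; rewrite /prange /pword e.
Qed.

Lemma icat_segP mu x y : psource mu = irange x ->
  (forall p, seg y 0 (plen mu + p) = pcat mu (seg x 0 p)) -> y = icat mu x.
Proof.
move=> h hy; apply: ipath_eqP => n.
have := hy n.+1; rewrite -seg_icat //.
move/(congr1 (fun s => nth (x 0) (pword s) n)).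
rewrite !pword_seg !subn0 !(nth_map 0%N) ?size_iota ?nth_iota ?addnS ?ltnS ?leq_addl //.
Qed.

Lemma prange_pcat mu nu : psource mu = prange nu ->
  prange (pcat mu nu) = prange mu.
Proof. by move=> h; rewrite {1}/prange val_pcat. Qed.

Lemma pword_pcat mu nu : psource mu = prange nu ->
  pword (pcat mu nu) = pword mu ++ pword nu.
Proof. by move=> h; rewrite {1}/pword val_pcat. Qed.

Lemma pcatA mu nu la : psource mu = prange nu -> psource nu = prange la ->
  pcat (pcat mu nu) la = pcat mu (pcat nu la).
Proof.
move=> h1 h2; have h3 : psource mu = prange (pcat nu la) by rewrite prange_pcat.
have h4 : psource (pcat mu nu) = prange la by rewrite psource_pcat.
by apply: fpath_eqP; rewrite ?prange_pcat // !pword_pcat // catA.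
Qed.

Lemma icatA mu nu x : psource mu = prange nu -> psource nu = irange x ->
  icat (pcat mu nu) x = icat mu (icat nu x).
Proof.
move=> h1 h2; apply/esym/icat_segP; first by rewrite psource_pcat.
move=> p; rewrite plen_pcat // -addnA seg_icat ?irange_icat //.
by rewrite seg_icat // pcatA.
Qed.

Lemma iact_icat g mu x : psource mu = irange x ->
  iact A g (icat mu x) = icat (act A g mu) (iact A (restr A g mu) x).
Proof.
move=> h; apply: icat_segP.
  by rewrite psource_act irange_iact -h vact_restr.
by move=> p; rewrite act_len !seg_iact0 seg_icat // act_cat.
Qed.

Lemma irestr_icat g mu x p : psource mu = irange x ->
  irestr A g (icat mu x) (plen mu + p) = irestr A (restr A g mu) x p.
Proof. by move=> h; rewrite /irestr seg_icat // restr_cat. Qed.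

Lemma icat_inj mu x y : psource mu = irange x -> psource mu = irange y ->
  icat mu x = icat mu y -> x = y.
Proof.
move=> hx hy e; apply: ipath_eqP => n.
have /(congr1 (fun z : ipath E => z (plen mu + n))) := e.
by rewrite !val_icat // ltnNge leq_addr addKn.
Qed.

End InfiniteActionTheory.

Section Arrows.
Variables (G : groupType) (E : finite_digraph) (A : self_similar_action G E).
Implicit Types (g h : G) (mu nu : fpath E) (x y : ipath E).

(* The set of all (x; [f], k; y) is a groupoid for these operations; the
   self-similar graph groupoid is a subset of it. The operations below do not
   test composability. *)
Definition quad : Type := (ipath E * germ G * int * ipath E)%type.
HB.instance Definition _ := Choice.on quad.
Implicit Types t u : quad.

Definition quad_range t : quad := let: (x, _, _, _) := t in (x, 1, 0%R, x).

Definition quad_source t : quad := let: (_, _, _, y) := t in (y, 1, 0%R, y).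

Definition quad_mul t u : quad :=
  let: (x, a, k, _) := t in
  let: (_, b, l, z) := u in (x, a * germ_shift k b, (k + l)%R, z).

Definition quad_inv t : quad :=
  let: (x, a, k, y) := t in (y, germ_shift (- k)%R a^-1, (- k)%R, x).

Lemma quad_compP t u : quad_source t = quad_range u <-> t.2 = u.1.1.1.
Proof.
by case: t u => [[[x a] k] y] [[[x' b] l] y'] /=; split=> [[]|->].
Qed.

Lemma quad_mulA t u v :
  quad_mul t (quad_mul u v) = quad_mul (quad_mul t u) v.
Proof.
case: t u v => [[[? a] k] ?] [[[? b] l] ?] [[[? c] m] ?] /=.
by rewrite germ_shiftM mulgA germ_shiftD addrA.
Qed.

Lemma quad_invM t u : quad_inv (quad_mul t u) = quad_mul (quad_inv u) (quad_inv t).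
Proof.
case: t u => [[[x a] k] y] [[[x' b] l] y'] /=.
rewrite invgM germ_shiftM -germ_shiftV -!germ_shiftD opprD.
by rewrite [(- l + - k)%R]addrC addrAC addNr add0r.
Qed.

Lemma quad_invK t : quad_inv (quad_inv t) = t.
Proof.
case: t => [[[x a] k] y] /=.
by rewrite -germ_shiftV invgK -germ_shiftD opprK addrN germ_shift0.
Qed.

(* The element (mu (g . x); T_|mu| [g|_x], |mu| - |nu|; nu x). *)
Definition ssg_elt mu g nu x : quad :=
  (icat mu (iact A g x), germ_shift (plen mu)%:Z%R (germ_of (irestr A g x)),
   ((plen mu)%:Z - (plen nu)%:Z)%R, icat nu x).

Definition ssg_set : set quad :=
  [set t | exists mu g nu x,
     [/\ psource mu = vact A g (psource nu), irange x = psource nu &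
         t = ssg_elt mu g nu x]].

Lemma ssg_range_closed t : ssg_set t -> ssg_set (quad_range t).
Proof.
case: t => [[[x a] k] y] _ /=; exists (vpath (irange x)), 1, (vpath (irange x)), x.
split=> //; first by rewrite vact1.
rewrite /ssg_elt iact1 icat_vpath // subrr germ_shift0.
by congr (_, germ_of _, _, _); apply/funext => p; rewrite irestr1.
Qed.

Lemma quad_inv_elt mu g nu x :
  quad_inv (ssg_elt mu g nu x) = ssg_elt nu g^-1 mu (iact A g x).
Proof.
rewrite /ssg_elt /= iactK opprB -germ_shiftV -germ_shiftD subrK germ_ofV.
by congr (_, germ_shift _ (germ_of _), _, _); apply/funext => p; rewrite irestrV.
Qed.

Lemma ssg_inv_closed t : ssg_set t -> ssg_set (quad_inv t).
Proof.
move=> [mu [g [nu [x [mn xn ->]]]]]; exists nu, g^-1, mu, (iact A g x).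
split; first by rewrite mn vactK.
  by rewrite irange_iact xn.
exact: quad_inv_elt.
Qed.

Lemma quad_source_inv t : quad_source t = quad_range (quad_inv t).
Proof. by case: t => [[[x a] k] y]. Qed.

Lemma quad_range_inv t : quad_range t = quad_source (quad_inv t).
Proof. by case: t => [[[x a] k] y]. Qed.

Lemma ssg_source_closed t : ssg_set t -> ssg_set (quad_source t).
Proof. by rewrite quad_source_inv => /ssg_inv_closed/ssg_range_closed. Qed.

Lemma ssg_mul_closed_le mu g nu x al h be y :
    psource mu = vact A g (psource nu) -> irange x = psource nu ->
    psource al = vact A h (psource be) -> irange y = psource be ->
    icat nu x = icat al (iact A h y) -> (plen nu <= plen al)%N ->
  ssg_set (quad_mul (ssg_elt mu g nu x) (ssg_elt al h be y)).
Proof.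
move=> mn xn ab yb e le; set k := (plen al - plen nu)%N; set la := seg x 0 k.
have nx : psource nu = irange x by [].
have nl : psource nu = prange la by rewrite nx.
have ahy : psource al = irange (iact A h y) by rewrite irange_iact yb.
have alE : al = pcat nu la.
  rewrite -(seg_icat0 ahy) -e -(subnKC le) -/k seg_icat //.
have la_hy : psource la = irange (iact A h y) by rewrite -ahy alE psource_pcat.
have xE : x = icat la (iact A h y).
  by apply: (icat_inj nx); rewrite ?irange_icat // e alE icatA.
have lenla : plen la = k by rewrite plen_seg subn0.
have lenal : plen al = (plen nu + k)%N by rewrite subnKC.
have mgl : psource mu = prange (act A g la) by rewrite prange_act mn nl.
exists (pcat mu (act A g la)), (restr A g la * h), be, y; split=> //.
  by rewrite psource_pcat // psource_act vactM -ab -vact_restr la_hy ahy.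
rewrite /ssg_elt /= plen_pcat // act_len lenla lenal iactM.
have -> : icat mu (iact A g x) =
    icat (pcat mu (act A g la)) (iact A (restr A g la) (iact A h y)).
  rewrite {1}xE iact_icat // icatA // psource_act irange_iact.
  by rewrite -vact_restr la_hy.
have kE : ((plen mu)%:Z - (plen nu)%:Z + (plen nu + k)%N%:Z)%R =
    (plen mu + k)%N%:Z%R by lia.
congr (_, _, _, _); last by lia.
rewrite -germ_shiftD kE PoszD germ_shiftD.
have -> : germ_of (irestr A g x) =
    germ_shift k%:Z%R (germ_of (irestr A (restr A g la) (iact A h y))).
  rewrite germ_shiftE; apply/germ_ofP; exists k => p kp.
  rewrite -(subnKC kp) {1}xE -lenla irestr_icat //.
  by apply/esym/shiftE; rewrite lenla; lia.
rewrite germ_shiftD -!germ_shiftM germ_ofM; congr germ_shift; congr germ_shift.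
by congr germ_of; apply/funext => p; rewrite irestrM.
Qed.

Lemma ssg_mul_closed t u : ssg_set t -> ssg_set u ->
  quad_source t = quad_range u -> ssg_set (quad_mul t u).
Proof.
move=> ht hu /quad_compP; move: ht hu.
move=> [mu [g [nu [x [mn xn ->]]]]] [al [h [be [y [ab yb ->]]]]] e.
case: (leqP (plen nu) (plen al)) => le; first exact: ssg_mul_closed_le.
rewrite -(quad_invK (quad_mul _ _)) quad_invM; apply: ssg_inv_closed.
rewrite !quad_inv_elt; apply: ssg_mul_closed_le.
- by rewrite ab vactK.
- by rewrite irange_iact yb.
- by rewrite mn vactK.
- by rewrite irange_iact xn.
- by rewrite iactK.
- exact: ltnW.
Qed.

(* The self-similar graph groupoid. *)
Record ssg := SSGArrow { ssg_val :> quad; ssg_valP : `[< ssg_set ssg_val >] }.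

HB.instance Definition _ := [isSub for ssg_val].
HB.instance Definition _ := [Choice of ssg by <:].

Lemma ssgP (a : ssg) : ssg_set a.
Proof. by have /asboolP := ssg_valP a. Qed.

Definition mk_ssg t (ht : ssg_set t) : ssg := SSGArrow (asboolT ht).

Definition ssg_range (a : ssg) : ssg := mk_ssg (ssg_range_closed (ssgP a)).
Definition ssg_source (a : ssg) : ssg := mk_ssg (ssg_source_closed (ssgP a)).
Definition ssg_inv (a : ssg) : ssg := mk_ssg (ssg_inv_closed (ssgP a)).
Definition ssg_mul (a b : ssg) : ssg := insubd a (quad_mul a b).

Lemma val_ssg_mul (a b : ssg) : ssg_source a = ssg_range b ->
  ssg_val (ssg_mul a b) = quad_mul a b.
Proof.
move=> /(congr1 ssg_val) h; apply: (@insubdK _ _ ssg); apply/asboolP.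
exact: ssg_mul_closed (ssgP a) (ssgP b) h.
Qed.

Lemma ssg_ext (a b : ssg) : ssg_val a = ssg_val b -> a = b.
Proof. exact: val_inj. Qed.

Lemma ssg_range_range a : ssg_range (ssg_range a) = ssg_range a.
Proof. by apply: ssg_ext => /=; case: (ssg_val a) => [[[]]]. Qed.

Lemma ssg_source_range a : ssg_source (ssg_range a) = ssg_range a.
Proof. by apply: ssg_ext => /=; case: (ssg_val a) => [[[]]]. Qed.

Lemma ssg_range_source a : ssg_range (ssg_source a) = ssg_source a.
Proof. by apply: ssg_ext => /=; case: (ssg_val a) => [[[]]]. Qed.

Lemma ssg_source_source a : ssg_source (ssg_source a) = ssg_source a.
Proof. by apply: ssg_ext => /=; case: (ssg_val a) => [[[]]]. Qed.

Lemma ssg_range_mul a b : ssg_source a = ssg_range b ->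
  ssg_range (ssg_mul a b) = ssg_range a.
Proof.
move=> ab; apply: ssg_ext; rewrite /= val_ssg_mul //.
by case: (ssg_val a) (ssg_val b) => [[[? ?] ?] ?] [[[]]].
Qed.

Lemma ssg_source_mul a b : ssg_source a = ssg_range b ->
  ssg_source (ssg_mul a b) = ssg_source b.
Proof.
move=> ab; apply: ssg_ext; rewrite /= val_ssg_mul //.
by case: (ssg_val a) (ssg_val b) => [[[? ?] ?] ?] [[[]]].
Qed.

Lemma ssg_mulA a b c : ssg_source a = ssg_range b -> ssg_source b = ssg_range c ->
  ssg_mul a (ssg_mul b c) = ssg_mul (ssg_mul a b) c.
Proof.
move=> ab bc; apply: ssg_ext.
rewrite !val_ssg_mul ?quad_mulA //; first by rewrite ssg_source_mul.
by rewrite ssg_range_mul.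
Qed.

Lemma ssg_mul1g a : ssg_mul (ssg_range a) a = a.
Proof.
apply: ssg_ext; rewrite val_ssg_mul ?ssg_source_range //=.
by case: (ssg_val a) => [[[x f] k] y] /=; rewrite mul1g germ_shift0 add0r.
Qed.

Lemma ssg_mulg1 a : ssg_mul a (ssg_source a) = a.
Proof.
apply: ssg_ext; rewrite val_ssg_mul ?ssg_range_source //=.
by case: (ssg_val a) => [[[x f] k] y] /=; rewrite germ_shift1 mulg1 addr0.
Qed.

Lemma ssg_range_inv a : ssg_range (ssg_inv a) = ssg_source a.
Proof. by apply: ssg_ext => /=; case: (ssg_val a) => [[[]]]. Qed.

Lemma ssg_source_inv a : ssg_source (ssg_inv a) = ssg_range a.
Proof. by apply: ssg_ext => /=; case: (ssg_val a) => [[[]]]. Qed.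

Lemma ssg_mulgV a : ssg_mul a (ssg_inv a) = ssg_range a.
Proof.
apply: ssg_ext; rewrite val_ssg_mul ?ssg_range_inv //=.
case: (ssg_val a) => [[[x f] k] y] /=.
by rewrite -germ_shiftD addrN germ_shift0 mulgV.
Qed.

Lemma ssg_mulVg a : ssg_mul (ssg_inv a) a = ssg_source a.
Proof.
apply: ssg_ext; rewrite val_ssg_mul ?ssg_source_inv //=.
case: (ssg_val a) => [[[x f] k] y] /=.
by rewrite -germ_shiftM mulVg germ_shift1 addNr.
Qed.

HB.instance Definition _ := isGroupoid.Build ssg
  ssg_range_range ssg_source_range ssg_range_source ssg_source_source
  ssg_range_mul ssg_source_mul ssg_mulA ssg_mul1g ssg_mulg1
  ssg_range_inv ssg_source_inv ssg_mulgV ssg_mulVg.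

Definition cylinder mu g nu : set ssg :=
  [set a | exists2 x, irange x = psource nu & ssg_val a = ssg_elt mu g nu x].

Definition cylinders : set (set ssg) :=
  [set Z | exists mu g nu,
     psource mu = vact A g (psource nu) /\ Z = cylinder mu g nu].

(* The topology generated by the cylinder sets. *)
HB.instance Definition _ := isSubBaseTopological.Build ssg cylinders id.

Definition cycline mu g nu : Prop :=
  psource mu = vact A g (psource nu) /\
  forall x, irange x = psource nu -> icat mu (iact A g x) = icat nu x.

Definition S_sym : set ssg :=
  [set a | exists mu g, cycline mu g mu /\ cylinder mu g mu a].

End Arrows.

Arguments cylinder {G E} A mu g nu.
Arguments cylinders {G E} A.
Arguments cycline {G E} A mu g nu.
Arguments S_sym {G E} A.

Lemma open_cylinder (G : groupType) (E : finite_digraph)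
    (A : self_similar_action G E) mu g nu :
  psource mu = vact A g (psource nu) -> open (cylinder A mu g nu).
Proof.
move=> mn; exists [set cylinder A mu g nu]; last by rewrite bigcup_set1.
move=> _ /= ->; exists [fset (cylinder A mu g nu)]%fset.
  by move=> Z /fset1P ->; apply/mem_set; exists mu, g, nu.
rewrite predeqE => a; split=> [/(_ (cylinder A mu g nu))|Za Z /=].
  by apply; rewrite /= !inE.
by rewrite inE => /eqP eZ; rewrite /= eZ.
Qed.

(* Main.v *)
Require Import Defs.
From mathcomp Require Import all_boot all_order all_algebra.
From mathcomp Require Import boolp classical_sets functions cardinality topology.

Local Open Scope classical_set_scope.
Local Open Scope group_scope.

(** A triple (mu, g, mu) is cycline exactly when g fixes s(mu) and every infinite
    path with range s(mu) (cycline_symP), so S_sym consists of the arrows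
    (mu x; T_|mu| [g|_x], 0; mu x) with g acting trivially on s(mu)E^oo.

    The difficulty is that the same arrow has many descriptions, and two
    composable arrows need not come with matching paths.  If a point is written
    mu x = nu y with |mu| <= |nu|, then nu = mu la and x = la y, and an arrow
    described at the cut (mu, x) can be described at the later cut (nu, y) by
    replacing g with g|_la (ssg_elt_pcat).  Triviality on the cone survives:
    if g fixes all paths la y, then g . la = la and g|_la fixes all y
    (acts_trivially_restr).  Hence any two composable arrows can be
    described at a common cut, where composing them amounts to multiplying the
    group elements (quad_mul_elt), and the algebraic claims become claims about
    G: the elements acting trivially on a cone are closed under products and
    inverses, they commute when G is abelian, and conjugating by g carries
    those that fix vE^oo to those that fix (g . v)E^oo.  Openness holds because
    S_sym is by construction a union of cylinder sets. *)

Section SymmetricCycline.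
Set Implicit Arguments.
Unset Strict Implicit.

Variables (G : groupType) (E : finite_digraph) (A : self_similar_action G E).
Implicit Types (g h : G) (v : vertex E) (mu nu la al : Defs.fpath E).
Implicit Types (x y : ipath E) (t u : quad G E) (a b : ssg A).

(** * Cutting an infinite path at two places *)

Lemma icat_eq_factor mu x nu y :
    psource mu = irange x -> psource nu = irange y ->
    icat mu x = icat nu y -> (plen mu <= plen nu)%N ->
  exists la, [/\ psource mu = prange la, psource la = irange y,
                 nu = pcat mu la & x = icat la y].
Proof.
move=> mx ny e le; exists (seg x 0 (plen nu - plen mu)).
have ml : psource mu = prange (seg x 0 (plen nu - plen mu)) by rewrite mx.
have nuE : nu = pcat mu (seg x 0 (plen nu - plen mu)).
  by have := seg_icat0 ny; rewrite -e -{1}(subnKC le) seg_icat.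
have ly : psource (seg x 0 (plen nu - plen mu)) = irange y.
  by rewrite -ny {2}nuE psource_pcat.
split=> //; apply: (icat_inj mx); first by rewrite irange_icat.
by rewrite -icatA // -nuE.
Qed.

(** The cut of an arrow can be moved along la because
    g . (la y) = (g . la)(g|_la . y); the germs agree because
    g|_(la y) is the sequence (g|_la)|_y delayed by |la|. *)
Lemma ssg_elt_pcat mu g nu la y :
    psource mu = vact A g (psource nu) ->
    psource nu = prange la -> psource la = irange y ->
  ssg_elt A mu g nu (icat la y) =
  ssg_elt A (pcat mu (act A g la)) (restr A g la) (pcat nu la) y.
Proof.
move=> mn nl ly.
have mgl : psource mu = prange (act A g la) by rewrite prange_act mn nl.
rewrite /ssg_elt !plen_pcat // act_len iact_icat // !icatA //; last first.
  by rewrite psource_act irange_iact -ly vact_restr.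
congr (_, _, _, _); last by rewrite !PoszD GRing.opprD GRing.addrACA GRing.subrr GRing.addr0.
rewrite PoszD germ_shiftD; congr germ_shift; rewrite germ_shiftE.
apply/germ_ofP; exists (plen la) => p lep.
rewrite -(subnKC lep) irestr_icat //; apply/esym/shiftE.
by rewrite PoszD GRing.addrC.
Qed.

(** At matching cuts the composition of arrows is the product in G; this is
    the cocycle identity (g h)|_y = g|_(h . y) h|_y. *)
Lemma quad_mul_elt mu g nu h la y :
  quad_mul (ssg_elt A mu g nu (iact A h y)) (ssg_elt A nu h la y) =
  ssg_elt A mu (g * h) la y.
Proof.
rewrite /ssg_elt /= iactM -germ_shiftD GRing.subrK -germ_shiftM germ_ofM.
rewrite GRing.addrA GRing.subrK.
by congr (_, germ_shift _ (germ_of _), _, _); apply/funext => p; rewrite irestrM.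
Qed.

(** * Group elements acting trivially on a cone *)

(** The first conjunct is kept separately because the cone could be empty. *)
Definition acts_trivially g v : Prop :=
  vact A g v = v /\ forall x, irange x = v -> iact A g x = x.

Lemma cycline_symP mu g : cycline A mu g mu <-> acts_trivially g (psource mu).
Proof.
split=> -[mg fixg]; split=> // x xm; last by rewrite fixg.
by apply: (icat_inj (mu := mu)); rewrite ?irange_iact ?xm ?fixg.
Qed.

Lemma acts_trivially1 v : acts_trivially 1 v.
Proof. by split=> [|x _]; rewrite ?vact1 ?iact1. Qed.

Lemma acts_triviallyM g h v :
  acts_trivially g v -> acts_trivially h v -> acts_trivially (g * h) v.
Proof.
move=> [gv fixg] [hv fixh]; split=> [|x xv]; first by rewrite vactM hv.
by rewrite iactM fixh // fixg.
Qed.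

Lemma acts_triviallyV g v : acts_trivially g v -> acts_trivially g^-1 v.
Proof.
move=> [gv fixg]; split=> [|x xv]; first by rewrite -{1}gv vactK.
by rewrite -{1}(fixg x xv) iactK.
Qed.

Lemma acts_trivially_conj g h v :
  acts_trivially h v -> acts_trivially (g * h * g^-1) (vact A g v).
Proof.
move=> [hv fixh]; split=> [|x xv]; first by rewrite !vactM vactK hv.
rewrite !iactM fixh; last by rewrite irange_iact xv vactK.
by rewrite -iactM mulgV iact1.
Qed.

(** Reading off the first |la| edges of g . (la y) = la y gives g . la = la, and
    cancelling them gives g|_la . y = y.  The path y provides the extension of
    la to an infinite path without which the first claim can fail. *)
Lemma acts_trivially_restr g la y :
    psource la = irange y -> acts_trivially g (prange la) ->
  act A g la = la /\ acts_trivially (restr A g la) (psource la).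
Proof.
move=> ly [gl fixg].
have gla : act A g la = la.
  by rewrite -{1}(seg_icat0 ly) -seg_iact0 fixg ?seg_icat0 ?irange_icat.
have rl : vact A (restr A g la) (psource la) = psource la.
  by rewrite vact_restr -psource_act gla.
split=> //; split=> // x xl; apply: (icat_inj (mu := la)) => //.
  by rewrite irange_iact xl rl.
by rewrite -{1}gla -iact_icat // fixg // irange_icat.
Qed.

(** * Symmetric arrows at a given cut *)

(** A description of an arrow of S_sym by a prescribed cut (mu, x) of its base
    point, so that two arrows can be required to share the cut. *)
Definition sym_at mu x t : Prop :=
  exists2 g, acts_trivially g (psource mu) & t = ssg_elt A mu g mu x.

Lemma S_symP a :
  S_sym A a <-> exists mu x, psource mu = irange x /\ sym_at mu x (ssg_val a).
Proof.
split=> [[mu [g [/cycline_symP gm [x xm aE]]]]|].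
  by exists mu, x; split=> //; exists g.
move=> [mu [x [mx [g gm aE]]]]; exists mu, g; split; first exact/cycline_symP.
by exists x.
Qed.

Lemma sym_at_ends mu x t : psource mu = irange x -> sym_at mu x t ->
  t.1.1.1 = icat mu x /\ t.2 = icat mu x.
Proof. by move=> mx [g [_ fixg] ->]; rewrite /= fixg. Qed.

Lemma quad_mul_sym mu g nu h x :
    psource nu = irange x -> acts_trivially h (psource nu) ->
  quad_mul (ssg_elt A mu g nu x) (ssg_elt A nu h nu x) =
  ssg_elt A mu (g * h) nu x.
Proof. by move=> nx [_ fixh]; rewrite -(quad_mul_elt _ _ nu) fixh. Qed.

Lemma sym_atM mu x t u : psource mu = irange x ->
  sym_at mu x t -> sym_at mu x u -> sym_at mu x (quad_mul t u).
Proof.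
move=> mx [g gm ->] [h hm ->]; exists (g * h); first exact: acts_triviallyM.
exact: quad_mul_sym.
Qed.

Lemma sym_atV mu x t : psource mu = irange x ->
  sym_at mu x t -> sym_at mu x (quad_inv t).
Proof.
move=> mx [g gm ->]; exists g^-1; first exact: acts_triviallyV.
by rewrite quad_inv_elt; case: gm => _ ->.
Qed.

Lemma sym_at_comm mu x t u : (forall g h, g * h = h * g) ->
    psource mu = irange x -> sym_at mu x t -> sym_at mu x u ->
  quad_mul t u = quad_mul u t.
Proof.
by move=> comm mx [g gm ->] [h hm ->]; rewrite !quad_mul_sym // comm.
Qed.

Lemma sym_at_later mu x nu y t :
    psource mu = irange x -> psource nu = irange y ->
    icat mu x = icat nu y -> (plen mu <= plen nu)%N ->
  sym_at mu x t -> sym_at nu y t.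
Proof.
move=> mx ny e le [g gm ->].
have [la [ml ly -> ->]] := icat_eq_factor mx ny e le.
rewrite ml in gm; have [gla rm] := acts_trivially_restr ly gm.
exists (restr A g la); first by rewrite psource_pcat.
by rewrite ssg_elt_pcat ?gla //; case: gm; rewrite ml.
Qed.

Lemma sym_at_common mu x nu y t u :
    psource mu = irange x -> psource nu = irange y ->
    icat mu x = icat nu y -> sym_at mu x t -> sym_at nu y u ->
  exists la z, [/\ psource la = irange z, sym_at la z t & sym_at la z u].
Proof.
move=> mx ny e tm un; have [le|/ltnW le] := leqP (plen mu) (plen nu).
  by exists nu, y; split=> //; apply: sym_at_later tm.
by exists mu, x; split=> //; apply: sym_at_later un.
Qed.

Lemma S_sym_common a b :
    S_sym A a -> S_sym A b -> gpd_source a = gpd_range b ->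
  exists mu x, [/\ psource mu = irange x, sym_at mu x (ssg_val a) &
                   sym_at mu x (ssg_val b)].
Proof.
move=> /S_symP[mu [x [mx am]]] /S_symP[nu [y [ny bn]]].
move=> /(congr1 (@ssg_val _ _ A))/quad_compP.
rewrite (sym_at_ends mx am).2 (sym_at_ends ny bn).1 => e.
exact: sym_at_common am bn.
Qed.

(** * The structure of S_sym *)

Lemma S_sym_mul a b : S_sym A a -> S_sym A b ->
  gpd_source a = gpd_range b -> S_sym A (gpd_mul a b).
Proof.
move=> aS bS ab; have [mu [x [mx am bm]]] := S_sym_common aS bS ab.
by apply/S_symP; exists mu, x; rewrite val_ssg_mul //; split=> //; apply: sym_atM.
Qed.

Lemma S_sym_inv a : S_sym A a -> S_sym A (gpd_inv a).
Proof.
move=> /S_symP[mu [x [mx am]]]; apply/S_symP.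
by exists mu, x; split=> //; apply: sym_atV.
Qed.

Lemma S_sym_isotropy : S_sym A `<=` @isotropy (ssg A).
Proof.
move=> a /S_symP[mu [x [mx am]]]; apply: ssg_ext => /=.
have [] := sym_at_ends mx am.
by case: (ssg_val a) => [[[z f] k] z'] /= -> ->.
Qed.

Lemma units_S_sym : @units (ssg A) `<=` S_sym A.
Proof.
move=> _ [a _ <-]; apply/S_symP => /=.
case: (ssg_val a) => [[[x f] k] y] /=; exists (vpath (irange x)), x.
split=> //; exists 1; first exact: acts_trivially1.
rewrite /ssg_elt iact1 icat_vpath // GRing.subrr germ_shift0.
by congr (_, germ_of _, _, _); apply/funext => p; rewrite irestr1.
Qed.

Lemma S_sym_comm a b : (forall g h, g * h = h * g) ->
    S_sym A a -> S_sym A b -> gpd_source a = gpd_range b ->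
  gpd_mul a b = gpd_mul b a.
Proof.
move=> comm aS bS ab; have [mu [x [mx am bm]]] := S_sym_common aS bS ab.
have ba : gpd_source b = gpd_range a.
  by rewrite (S_sym_isotropy aS) ab (S_sym_isotropy bS).
apply: ssg_ext; rewrite !val_ssg_mul //; exact: (sym_at_comm comm mx am bm).
Qed.

(** The conjugate is a composition of three arrows with matching cuts, because
    the inverse of (mu, g, nu) at x is (nu, g^-1, mu) at g . x and h fixes x. *)
Lemma sym_at_conj mu g nu x t :
    psource mu = vact A g (psource nu) -> psource nu = irange x ->
    sym_at nu x t ->
  sym_at mu (iact A g x)
    (quad_mul (quad_mul (ssg_elt A mu g nu x) t)
              (quad_inv (ssg_elt A mu g nu x))).
Proof.
move=> mn nx [h hn ->]; exists (g * h * g^-1).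
  by rewrite mn; apply: acts_trivially_conj.
rewrite quad_inv_elt quad_mul_sym //.
by rewrite -{1}[x](iactK A g) quad_mul_elt.
Qed.

Lemma S_sym_conj a b : S_sym A b -> gpd_range b = gpd_source a ->
  S_sym A (gpd_mul (gpd_mul a b) (gpd_inv a)).
Proof.
move=> bS ba; have ab := esym ba; apply/S_symP.
have -> : ssg_val (gpd_mul (gpd_mul a b) (gpd_inv a)) =
    quad_mul (quad_mul (ssg_val a) (ssg_val b)) (quad_inv (ssg_val a)).
  rewrite !val_ssg_mul //.
  by rewrite [LHS]gpd_source_mul // -(S_sym_isotropy bS) ba [RHS]gpd_range_inv.
have [mu [g [nu [x [mn xn aE]]]]] := ssgP a.
have [al [y [ay bal]]] := (S_symP b).1 bS.
have e : icat nu x = icat al y.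
  move/(congr1 (@ssg_val _ _ A))/quad_compP: ab.
  by rewrite aE (sym_at_ends ay bal).1.
(* Only the shorter of the two cuts of the common point has to be moved. *)
rewrite aE; have [le|/ltnW le] := leqP (plen al) (plen nu).
  exists mu, (iact A g x); split; first by rewrite irange_iact mn xn.
  by apply: sym_at_conj => //; apply: sym_at_later bal.
have [la [nl ly alE ->]] := icat_eq_factor (esym xn) ay e le.
have mgl : psource mu = prange (act A g la) by rewrite prange_act mn nl.
have src : psource (pcat mu (act A g la)) = vact A (restr A g la) (psource al).
  by rewrite alE !psource_pcat // psource_act vact_restr.
rewrite ssg_elt_pcat // -alE.
exists (pcat mu (act A g la)), (iact A (restr A g la) y).
by split; [rewrite irange_iact src ay | exact: sym_at_conj].
Qed.

Lemma open_S_sym : open (S_sym A).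
Proof.
have -> : S_sym A =
    \bigcup_(p in [set p : Defs.fpath E * G | cycline A p.1 p.2 p.1])
      cylinder A p.1 p.2 p.1.
  rewrite predeqE => a; split=> [[mu [g [mgm am]]]|[[mu g] /= mgm am]].
    by exists (mu, g).
  by exists mu, g.
by apply: bigcup_open => -[mu g] /= [mg _]; exact: open_cylinder.
Qed.

End SymmetricCycline.

Theorem proposition3p3 (G : groupType) (E : finite_digraph)
    (A : self_similar_action G E)
    (G_countable : countable [set: G])
    (G_abelian : forall g h : G, g * h = h * g)
    (E_source_free : source_free E) :
  [/\ subgroupoid (S_sym A),
      open (S_sym A),
      gpd_abelian (S_sym A) &
      gpd_normal (S_sym A)].
Proof.
split.
- by split=> [a b|a]; [exact: S_sym_mul | exact: S_sym_inv].
- exact: open_S_sym.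
- by split=> [|a b]; [exact: S_sym_isotropy | exact: S_sym_comm].
- by split; [exact: units_S_sym | exact: S_sym_isotropy | exact: S_sym_conj].
Qed.
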